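(* There is a constant $C>0$, depending only on $\omega$, such that the following holds. Let $E$ be an arbitrary nonempty subset of a Hilbert space $(X,|\cdot|)$, and let $(f,G):E\to\mathbb{R}\times X$ be a $1$-jet. Then there exists $F\in C^{1,\omega}(X)$ with $F$ Lipschitz and $(F,\nabla F)_{|_E}=(f,G)$ if and only if $f$ is Lipschitz, $G$ is bounded and $A(f,G)<\infty$. In such case $F$ can be taken with the additional property that $$A(F,\nabla F)+\mathrm{Lip}(F)\le C\left(A(f,G)+\mathrm{Lip}(f)+\|G\|_\infty\right).$$
   Context: Spaces are real. $\omega:[0,\infty)\to[0,\infty)$ is a modulus of continuity: a concave, increasing, continuous function with $\omega(0)=0$ and $\lim_{t\to\infty}\omega(t)=\infty$. Put $\varphi(t)=\int_0^t\omega(s)\,ds$ for $t\ge0$. A $1$-jet on $E$ is a pair of functions $f:E\to\mathbb{R}$, $G:E\to X$ (the dual of $X$ is identified with $X$). $C^{1,\omega}(X)$ is the set of Fréchet differentiable $g:X\to\mathbb{R}$ for which there is a constant $K>0$ with $|\nabla g(x)-\nabla g(y)|\le K\omega(|x-y|)$ for all $x,y\in X$. For a $1$-jet $(f,G)$ on $E$, $$A(f,G)=\sup_{x\in X;\ y,z\in E,\ |x-y|+|x-z|>0}\frac{|f(y)+\langle G(y),x-y\rangle-f(z)-\langle G(z),x-z\rangle|}{\varphi(|x-y|)+\varphi(|x-z|)}.$$ For differentiable $F:X\to\mathbb{R}$, $A(F,\nabla F)$ is this quantity for the jet $(F,\nabla F)$ on $E=X$. $\mathrm{Lip}(\cdot)$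 is the best Lipschitz constant of a function on its domain, and $\|G\|_\infty=\sup_{y\in E}|G(y)|$. *)

(* Defs.v *)
From mathcomp Require Export all_boot all_order all_algebra.
From mathcomp Require Export sesquilinear.
From mathcomp Require Export all_classical all_reals all_analysis.
Export Order.TTheory GRing.Theory Num.Theory.
Export numFieldNormedType.Exports.

Set Implicit Arguments.
Unset Strict Implicit.
Unset Printing Implicit Defensive.

Local Open Scope classical_set_scope.
Local Open Scope ring_scope.

(* omega : [0, +oo[ -> [0, +oo[ is represented by a function on the whole line
   of which only the values on [0, +oo[ are ever used.  Nonnegativity there
   follows from [moc_nondecreasing] and [moc0]; strict monotonicity follows
   from monotonicity, concavity and [moc_unbounded]. *)
Record modulus_of_continuity (R : realType) (omega : R -> R) : Prop := {
  moc_concave :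
    convex_function (E := R^o) `[0, +oo[%classic (fun t => - omega t) ;
  moc_nondecreasing : {in `[0, +oo[ &, {homo omega : s t / s <= t}} ;
  moc_continuous : {within `[0, +oo[, continuous omega} ;
  moc0 : omega 0 = 0 ;
  moc_unbounded : omega t @[t --> +oo] --> +oo }.

Definition phi (R : realType) (omega : R -> R) (t : R) : R :=
  \int[lebesgue_measure]_(s in `[0, t]) omega s.

Section Jets.
Context {R : realType}.

(* A real Hilbert space is a complete normed space X with an inner product
   [ip : {dot X for idfun}] (a symmetric positive definite bilinear form) that
   induces the norm of X. *)
Definition induces_norm (X : normedModType R) (ip : {dot X for idfun}) : Prop :=
  forall x : X, ip x x = `|x| ^+ 2.

(* The Riesz representative of the Frechet derivative of F at x; it exists and
   is unique wherever F is differentiable and X is complete. *)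
Definition grad (X : normedModType R) (ip : {dot X for idfun}) (F : X -> R)
    (x : X) : X :=
  xget 0 [set v : X | forall h : X, 'd F x h = ip v h].

Definition C1omega (X : normedModType R) (ip : {dot X for idfun})
    (omega : R -> R) (F : X -> R) : Prop :=
  (forall x : X, differentiable F x) /\
  exists K : R, 0 < K /\
    forall x y : X, `|grad ip F x - grad ip F y| <= K * omega `|x - y|.

(* The functions f, G of a 1-jet on E are defined on all of X, but only their
   values on E are used.  All the quotients are nonnegative, so adjoining 0
   matters only if X is trivial: then no triple (x, y, z) is admissible and the
   supremum is 0 instead of -oo. *)
Definition jetA (X : normedModType R) (ip : {dot X for idfun})
    (omega : R -> R) (E : set X) (f : X -> R) (G : X -> X) : \bar R :=
  ereal_sup ([set 0%E] `|` [set a : \bar R | exists x y z : X,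
    [/\ E y, E z, 0 < `|x - y| + `|x - z| &
        a = (`|f y + ip (G y) (x - y) - f z - ip (G z) (x - z)|
             / (phi omega `|x - y| + phi omega `|x - z|))%:E]]).

(* +oo if f is not Lipschitz on E. *)
Definition Lip (X : normedModType R) (E : set X) (f : X -> R) : \bar R :=
  ereal_inf [set L%:E | L in [set L : R | 0 <= L /\ L.-lipschitz_E f]].

(* Meant for nonempty E; +oo if G is not bounded on E. *)
Definition supnorm (X : normedModType R) (E : set X) (G : X -> X) : \bar R :=
  ereal_sup [set `|G y|%:E | y in E].

End Jets.

(* Main.v *)
Require Import Defs.
From HB Require Import structures.
From mathcomp Require Import ring lra.

Set Implicit Arguments.
Unset Strict Implicit.
Unset Printing Implicit Defensive.

Local Open Scope classical_set_scope.
Local Open Scope ring_scope.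

(** Write [W] for the primitive [phi omega]. Call [h] paraconvex with constant
    [K] if its convexity defect on the segment from [x] to [y] is at most
    [K l (1 - l) W |x - y|]. A function that is paraconvex together with its
    opposite, and Lipschitz, has at every point an affine expansion with error
    [K W |v|] ([paraconvex_gradient]), and such an expansion everywhere makes
    the gradient vary by at most [6 K omega |x - y|] ([expansion_modulus]). So
    it is enough to extend the jet by a function of this kind.

    The finiteness of [A(f,G)] says that each lower function
    [f z + <G z, x - z> - M W |x - z|] lies below each upper function
    [f y + <G y, x - y> + M W |x - y|]. In a Hilbert space [W |.|] has a
    paraconvex opposite ([primitive_norm_upper]), hence the lower functions are
    paraconvex and so is the opposite of the infimum [g] of the upper ones. The
    extension is the envelope [F] of [g], the largest paraconvex function below
    [g]. It lies between the lower functions and [g], which forces its value and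
    its gradient on [E]. The opposite of [F] is paraconvex as well, because
    the class of paraconvex functions is convex and invariant under
    translations: the average [l F(. + a) + (1 - l) F(. + b)], lowered by the
    defect allowed to [g], is a paraconvex function below [g], hence below [F]
    ([envelope_paraconcave]). The same argument with one translate shows that
    [F] is as Lipschitz as [g] ([envelope_lipschitz]).

    As [W] grows faster than linearly, [g] is not Lipschitz. The
    construction therefore uses the primitive of [omega] frozen at [omega 1]:
    it agrees with [W] up to [1] and is linear beyond, where the Lipschitz bound
    on [f] and the bound on [G] replace [A(f,G)] in the comparison of lower and
    upper functions, with a factor that involves only [W 1].

    Conversely, by the mean value theorem an extension of the jet has an
    expansion with error proportional to [W] ([grad_modulus_expansion]), from
    which the three conditions on the jet follow. *)

(** * Moduli and their primitives *)

(** A modulus [w] together with a function [W] that behaves as its primitive.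
    The two bounds on the increments of [W] are all that is used about
    integration, and truncation preserves them without computing any integral.
    Concavity enters only through [mp_star]: [w t / t] does not increase. *)
Record modulus_primitive (R : realType) (w W : R -> R) : Prop := {
  mp_homo : forall s t : R, 0 <= s -> s <= t -> w s <= w t ;
  mp_star : forall s t : R, 0 <= s -> s <= t -> s * w t <= t * w s ;
  mp_small : forall e : R, 0 < e ->
    exists2 d, 0 < d & forall t, 0 <= t -> t <= d -> w t <= e ;
  mp0 : W 0 = 0 ;
  mp_lb : forall a b : R, 0 <= a -> a <= b -> (b - a) * w a <= W b - W a ;
  mp_ub : forall a b : R, 0 <= a -> a <= b -> W b - W a <= (b - a) * w b }.

Section ModulusPrimitive.
Context {R : realType} {w W : R -> R} (wW : modulus_primitive w W).

Lemma modulus_ge0 t : 0 <= t -> 0 <= w t.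
Proof.
move=> t0; have := mp_star wW (lexx 0) ler01; rewrite mul0r mul1r => w0.
exact: le_trans w0 (mp_homo wW (lexx 0) t0).
Qed.

Lemma primitive_homo a b : 0 <= a -> a <= b -> W a <= W b.
Proof.
move=> a0 ab; rewrite -subr_ge0; apply: le_trans (mp_lb wW a0 ab).
by rewrite mulr_ge0 ?subr_ge0// modulus_ge0.
Qed.

Lemma primitive_ge0 t : 0 <= t -> 0 <= W t.
Proof. by move=> t0; rewrite -(mp0 wW) primitive_homo. Qed.

Lemma primitive_le_mul t : 0 <= t -> W t <= t * w t.
Proof. by move=> t0; have := mp_ub wW (lexx 0) t0; rewrite (mp0 wW) !subr0. Qed.

Lemma modulus_half t : 0 <= t -> w t <= 2 * w (t / 2).
Proof.
rewrite le_eqVlt => /predU1P[<-|t0].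
  by rewrite mul0r; have := modulus_ge0 (lexx 0); lra.
have h0 : 0 <= t / 2 by lra.
have ht : t / 2 <= t by lra.
have := mp_star wW h0 ht => H.
by rewrite -(ler_pM2l t0); move: H; lra.
Qed.

Lemma mul_le_primitive t : 0 <= t -> t * w t <= 4 * W t.
Proof.
move=> t0; have h0 : 0 <= t / 2 by lra.
have ht : t / 2 <= t by lra.
have := mp_lb wW h0 ht; have := primitive_ge0 h0.
have := ler_wpM2l t0 (modulus_half t0); nra.
Qed.

Lemma primitive_scale l t : 0 <= l -> l <= 1 -> 0 <= t -> W (l * t) <= l * W t.
Proof.
move=> l0 l1 t0.
have lt0 : 0 <= l * t by exact: mulr_ge0.
have ltt : l * t <= t by rewrite ler_piMl.
have := mp_lb wW lt0 ltt; have := primitive_le_mul lt0.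
have l1' : 0 <= 1 - l by lra.
move=> /(ler_wpM2l l1') H1 /(ler_wpM2l l0) H2; nra.
Qed.

Lemma primitive_double t : 0 <= t -> W (2 * t) <= 4 * (t * w t).
Proof.
move=> t0; have t20 : 0 <= 2 * t by lra.
apply: le_trans (primitive_le_mul t20) _.
have := modulus_half t20; rewrite (_ : 2 * t / 2 = t); last by field.
move=> /(ler_wpM2l t20); lra.
Qed.

Lemma modulus_subadd s t : 0 <= s -> 0 <= t -> w (s + t) <= w s + w t.
Proof.
move=> s0 t0; have [st0|st0] := eqVneq (s + t) 0.
  have -> : s = 0 by lra.
  have -> : t = 0 by lra.
  by rewrite addr0 lerDl modulus_ge0.
have stp : 0 < s + t by rewrite lt_neqAle eq_sym st0 addr_ge0.
have st1 : s <= s + t by lra.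
have st2 : t <= s + t by lra.
have := mp_star wW s0 st1; have := mp_star wW t0 st2 => H1 H2.
by rewrite -(ler_pM2l stp); nra.
Qed.

(** Moving away from [a], the slope [w] changes by at most [w `|b - a|]. *)
Lemma primitive_tangent a b : 0 <= a -> 0 <= b ->
  W b <= W a + w a * (b - a) + 4 * W `|b - a|.
Proof.
move=> a0 b0; have [ab|ba] := leP a b.
  have d0 : 0 <= b - a by lra.
  rewrite ger0_norm//; have := mul_le_primitive d0.
  have := mp_ub wW a0 ab.
  have := modulus_subadd a0 d0; rewrite addrC subrK => /(ler_wpM2l d0); nra.
have d0 : 0 <= a - b by lra.
rewrite distrC ger0_norm//; have := mul_le_primitive d0.
have := mp_lb wW b0 (ltW ba).
have := modulus_subadd b0 d0; rewrite addrC subrK => /(ler_wpM2l d0); nra.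
Qed.

Lemma primitive_small r e : 0 <= r -> 0 < e ->
  exists2 d, 0 < d & forall s, 0 < s -> s <= d -> W (s * r) <= s * e.
Proof.
move=> r0 e0; have r1 : 0 < r + 1 by lra.
have [d d0 wd] := mp_small wW (divr_gt0 e0 r1).
exists (d / (r + 1)); first exact: divr_gt0.
move=> s s0; rewrite ler_pdivlMr// => sd.
have sr0 : 0 <= s * r by rewrite mulr_ge0// ltW.
apply: le_trans (primitive_le_mul sr0) _.
rewrite -mulrA ler_pM2l//.
have : w (s * r) <= e / (r + 1) by apply: wd => //; nra.
rewrite ler_pdivlMr// => h; have := modulus_ge0 sr0; nra.
Qed.

End ModulusPrimitive.

(** Freezing the modulus at its value in [1] makes the primitive grow linearly,
    without changing it on [[0, 1]]. *)
Definition truncw (R : realType) (w : R -> R) (t : R) : R := w (Num.min t 1).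

Definition truncW (R : realType) (w W : R -> R) (t : R) : R :=
  if t <= 1 then W t else W 1 + w 1 * (t - 1).

Lemma truncated_modulus_primitive (R : realType) (w W : R -> R) :
  modulus_primitive w W -> modulus_primitive (truncw w) (truncW w W).
Proof.
move=> wW; split; rewrite /truncw /truncW.
- move=> s t s0 st; apply: (mp_homo wW); first by rewrite le_min s0 ler01.
  by rewrite le_min !ge_min st lexx orbT.
- move=> s t s0 st; have [t1|t1] := leP t 1.
    by rewrite (min_l (le_trans st t1)); exact: (mp_star wW).
  have [s1|s1] := leP s 1; last first.
    by rewrite ler_wpM2r// (modulus_ge0 wW).
  have := mp_star wW s0 s1; rewrite mul1r => /le_trans; apply.
  by rewrite ler_peMl ?(modulus_ge0 wW)// ltW.
- move=> e /(mp_small wW)[d d0 wd]; exists (Num.min d 1).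
    by rewrite lt_min d0 ltr01.
  move=> t t0; rewrite le_min => /andP[td t1].
  by rewrite min_l//; exact: wd.
- by rewrite ler01 (mp0 wW).
- move=> a b a0 ab; have [b1|b1] := leP b 1.
    have a1 := le_trans ab b1; rewrite a1 (min_l a1); exact: (mp_lb wW).
  have [a1|a1] := leP a 1; last by lra.
  have := mp_lb wW a0 a1; have := mp_homo wW a0 a1.
  have : 0 < b - 1 by lra.
  nra.
- move=> a b a0 ab; have [b1|b1] := leP b 1.
    have a1 := le_trans ab b1; rewrite a1; exact: (mp_ub wW).
  have [a1|a1] := leP a 1; last by lra.
  by have := mp_ub wW a0 a1; lra.
Qed.

Section Truncation.
Context {R : realType} {w W : R -> R} (wW : modulus_primitive w W).

Lemma truncw_le t : 0 <= t -> truncw w t <= w t.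
Proof.
by move=> t0; apply: (mp_homo wW); rewrite ?le_min ?t0 ?ler01// ge_min lexx.
Qed.

Lemma truncw_le1 t : 0 <= t -> truncw w t <= w 1.
Proof.
by move=> t0; apply: (mp_homo wW); rewrite ?le_min ?t0 ?ler01// ge_min lexx orbT.
Qed.

Lemma truncW_le t : 0 <= t -> truncW w W t <= W t.
Proof.
move=> t0; rewrite /truncW; have [//|t1] := leP t 1.
have := mp_lb wW ler01 (ltW t1); lra.
Qed.

Lemma truncW_lipschitz a b : 0 <= a -> 0 <= b ->
  truncW w W a - truncW w W b <= w 1 * `|a - b|.
Proof.
move=> a0 b0; have tW := truncated_modulus_primitive wW.
have w10 := modulus_ge0 wW (@ler01 R).
have [ab|/ltW ba] := leP a b.
  have := primitive_homo tW a0 ab; rewrite -subr_le0 => /le_trans; apply.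
  exact: mulr_ge0.
apply: le_trans (mp_ub tW b0 ba) _.
rewrite ger0_norm ?subr_ge0// mulrC ler_wpM2r ?subr_ge0//.
exact: truncw_le1.
Qed.

Lemma truncW_linear t : 1 <= t -> W 1 * t <= truncW w W t.
Proof.
rewrite le_eqVlt => /predU1P[<-|t1]; first by rewrite /truncW lexx mulr1.
rewrite /truncW (lt_geF t1).
have := primitive_le_mul wW (@ler01 R); rewrite mul1r => /ler_wpM2r H.
by have := H (t - 1); rewrite subr_ge0 => /(_ (ltW t1)); lra.
Qed.

End Truncation.

(** Monotonicity of [omega] bounds its integral over [[a, b]], and concavity
    together with [omega 0 = 0] gives [mp_star]. *)
Lemma moc_primitive (R : realType) (omega : R -> R) :
  modulus_of_continuity omega -> modulus_primitive omega (phi omega).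
Proof.
move=> mo.
have inR (t : R) : 0 <= t -> t \in `[0, +oo[ by rewrite in_itv/= andbT.
have homo (s t : R) : 0 <= s -> s <= t -> omega s <= omega t.
  by move=> s0 st; apply: (moc_nondecreasing mo) => //; apply: inR => //; lra.
have intg (a b : R) : 0 <= a -> a <= b ->
    (@lebesgue_measure R).-integrable `[a, b] (EFin \o omega).
  move=> a0 ab; apply: continuous_compact_integrable; first exact: segment_compact.
  apply: continuous_subspaceW (moc_continuous mo) => x /=.
  by rewrite !in_itv/= andbT => /andP[ax _]; lra.
have incr (a b : R) : 0 <= a -> a <= b -> phi omega b - phi omega a =
    \int[lebesgue_measure]_(s in `[a, b]) omega s.
  move=> a0 ab; rewrite /phi Rintegral_itvB ?bnd_simp//; last first.
    exact: intg (le_trans a0 ab).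
  rewrite Rintegral_itv_obnd_cbnd//.
  by apply: integrableS (intg _ _ a0 ab) => //; exact: subset_itv_oc_cc.
have cstI (a b c : R) : a <= b ->
    \int[lebesgue_measure]_(s in `[a, b]) c = (b - a) * c.
  move=> ab; rewrite Rintegral_cst//= lebesgue_measure_itv/= lte_fin.
  by case: ltgtP ab => // [ab _|->]/=; rewrite ?subrr mulrC.
have cstint a b (c : R) : (@lebesgue_measure R).-integrable `[a, b] (EFin \o cst c).
  apply: continuous_compact_integrable; first exact: segment_compact.
  by apply: continuous_subspaceT => x; exact: cvg_cst.
split => //.
- move=> s t s0; rewrite le_eqVlt => /predU1P[->//|st].
  have t0 : 0 < t by lra.
  have l0 : 0 <= s / t by rewrite divr_ge0// ltW.
  have l1 : s / t <= 1 by rewrite ler_pdivrMr// mul1r ltW.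
  have := @moc_concave _ _ mo (Itv01 l0 l1) t 0.
  rewrite !inE/= !in_itv/= !andbT lexx ltW// => /(_ isT isT).
  have cE : conv (Itv01 l0 l1) (t : convex_lmodType R^o) 0 = s.
    rewrite /conv/=. by rewrite /= scaler0 addr0; apply: divfK; rewrite gt_eqF.
  rewrite cE convRE/= (moc0 mo) oppr0 mulr0 addr0.
  rewrite mulrN lerN2 => H; have := ler_wpM2l (ltW t0) H.
  by rewrite mulrA mulrCA divff ?gt_eqF// mulr1.
- move=> e e0; have /continuous_within_itvcyP[_] := moc_continuous mo.
  rewrite (moc0 mo) => /cvgrPdist_lt/(_ _ e0).
  rewrite near_withinE => /nbhs_ballP[d/= d0 H].
  exists (d / 2); first by rewrite divr_gt0.
  move=> t; rewrite le_eqVlt => /predU1P[<- _|t0 td]; first by rewrite (moc0 mo) ltW.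
  have := H t; rewrite /ball/= sub0r normrN gtr0_norm// => /(_ _ t0).
  rewrite sub0r normrN => h.
  apply: ltW; apply: le_lt_trans (ler_norm _) (h _); lra.
- by rewrite /phi set_itv1 Rintegral_set1.
- move=> a b a0 ab; rewrite incr// -cstI//; apply: le_Rintegral => //;
    [exact: cstint|exact: intg|].
  by move=> x /=; rewrite in_itv/= => /andP[ax _]; exact: homo.
- move=> a b a0 ab; rewrite incr// -cstI//; apply: le_Rintegral => //;
    [exact: intg|exact: cstint|].
  by move=> x /=; rewrite in_itv/= => /andP[ax xb]; apply: homo => //; lra.
Qed.

(** * Inner products and Riesz representation *)

Section InnerProduct.
Context {R : realType} {X : normedModType R} {ip : {dot X for idfun}}.
Hypothesis hip : induces_norm ip.

Lemma ip_sym (u v : X) : ip u v = ip v u.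
Proof. by rewrite hermC expr0 mul1r. Qed.

Lemma normD_sqr (u v : X) : `|u + v| ^+ 2 = `|u| ^+ 2 + 2 * ip u v + `|v| ^+ 2.
Proof.
rewrite -!hip linearDl !linearDr/= (ip_sym v u); ring.
Qed.

(** Cauchy-Schwarz is the triangle inequality squared. *)
Lemma ip_le (u v : X) : ip u v <= `|u| * `|v|.
Proof.
have := normD_sqr u v; have := ler_normD u v; have := normr_ge0 (u + v).
by have := normr_ge0 u; have := normr_ge0 v; nra.
Qed.

Lemma normr_ip_le (u v : X) : `|ip u v| <= `|u| * `|v|.
Proof.
rewrite ler_norml ip_le andbT lerNl; have := ip_le (- u) v.
by rewrite linearNl/= normrN.
Qed.

Lemma ip_inj (u v : X) : (forall h, ip u h = ip v h) -> u = v.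
Proof.
move=> uv; apply/eqP; rewrite -subr_eq0 -normr_eq0 -sqrf_eq0 -hip linearBl/=.
by rewrite uv subrr.
Qed.

End InnerProduct.

Lemma quadratic_ge0 (R : realType) (a b c : R) : 0 < b ->
  (forall t, 0 <= a + 2 * t * c + t ^+ 2 * b) -> c ^+ 2 <= a * b.
Proof.
move=> b0 /(_ (- c / b)) H; have : 0 <= (a + 2 * (- c / b) * c + (- c / b) ^+ 2 * b) * b.
  by rewrite mulr_ge0// ltW.
suff -> : (a + 2 * (- c / b) * c + (- c / b) ^+ 2 * b) * b = a * b - c ^+ 2 by lra.
by field; rewrite gt_eqF.
Qed.

(** The representative of [D] is the minimiser of [|v|^2 - 2 D v]; minimising
    sequences are Cauchy by the parallelogram identity. *)
Lemma riesz (R : realType) (X : completeNormedModType R) (ip : {dot X for idfun})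
    (D : X -> R) (L : R) : induces_norm ip -> scalar D ->
  (forall v, D v <= L * `|v|) -> exists u : X, forall h, D h = ip u h.
Proof.
move=> hip Dlin DL.
have DD u v : D (u + v) = D u + D v by rewrite -[u]scale1r Dlin mul1r scale1r.
have D0 : D 0 = 0 by have := DD 0 0; rewrite addr0; lra.
have DZ a v : D (a *: v) = a * D v by rewrite -[a *: v]addr0 Dlin D0 addr0.
pose J v := `|v| ^+ 2 - 2 * D v.
have JlbL v : - L ^+ 2 <= J v.
  by rewrite /J; have := DL v; have := sqr_ge0 (`|v| - L); nra.
have hJ : has_inf (range J).
  by split; [exists (J 0), 0|exists (- L ^+ 2) => _ [v _ <-]].
pose m := inf (range J).
have mJ v : m <= J v by apply: ge_inf; [case: hJ|exists v].
have Jmid u v : `|u - v| ^+ 2 <= 2 * (J u - m) + 2 * (J v - m).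
  have := mJ (2^-1 *: (u + v)); rewrite /J DZ DD normrZ gtr0_norm ?invr_gt0//.
  rewrite exprMn (normD_sqr hip u v) (normD_sqr hip u (- v)) linearNr/= normrN.
  lra.
have ex n : exists v, J v < m + (n.+1%:R^-1) ^+ 2.
  have e0 : 0 < (n.+1%:R^-1 : R) ^+ 2 by rewrite exprn_gt0.
  by have [_ [v _ <-] ?] := inf_adherent e0 hJ; exists v.
pose v n := projT1 (cid (ex n)).
have Jv n : J (v n) < m + (n.+1%:R^-1) ^+ 2 by rewrite /v; case: cid.
have vC n k : `|v n - v k| <= 2 * n.+1%:R^-1 + 2 * k.+1%:R^-1.
  have n0 : 0 <= (n.+1%:R^-1 : R) by [].
  have k0 : 0 <= (k.+1%:R^-1 : R) by [].
  have := Jmid (v n) (v k); have := Jv n; have := Jv k.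
  have := normr_ge0 (v n - v k).
  move: n0 k0; set a := n.+1%:R^-1; set b := k.+1%:R^-1; nra.
have /cauchy_cvgP vcvg : cauchy (v @ \oo).
  apply: cauchy_exP => e e0; have e4 : 0 < e / 4 by lra.
  have [N _ HN] := near_infty_natSinv_lt (PosNum e4).
  exists (v N), N => // n /= Nn.
  rewrite -ball_normE/=; apply: le_lt_trans (vC N n) _.
  have h1 : n.+1%:R^-1 < e / 4 := HN n Nn.
  have h2 : N.+1%:R^-1 < e / 4 := HN N (leqnn N).
  have G (x y r : R) : x < r / 4 -> y < r / 4 -> 2 * x + 2 * y < r by lra.
  exact: G.
set u := lim (v @ \oo) in vcvg.
exists u => h; have [->|h0] := eqVneq h 0; first by rewrite D0 linear0r.
have hh : 0 < `|h| ^+ 2 by rewrite exprn_gt0// normr_gt0.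
have c n : `|ip (v n) h - D h| <= n.+1%:R^-1 * `|h|.
  have : (ip (v n) h - D h) ^+ 2 <= (n.+1%:R^-1) ^+ 2 * `|h| ^+ 2.
    apply: quadratic_ge0 => // t.
    have := mJ (v n + t *: h); have := Jv n; rewrite /J (normD_sqr hip) linearZr/= DD DZ.
    rewrite normrZ exprMn -normrX ger0_norm ?sqr_ge0//.
    have G (a d i k g q r : R) : a - 2 * d < m + k ->
      m <= a + 2 * (r * i) + r ^+ 2 * q - 2 * (d + r * g) ->
      0 <= k + 2 * r * (i - g) + r ^+ 2 * q by move: (m) => m'; lra.
    exact: G.
  by rewrite -exprMn -real_normK ?num_real// ler_pXn2r// nnegrE ?mulr_ge0.
apply/eqP; rewrite eq_sym -subr_eq0 -normr_le0; apply/ler_addgt0Pl => e e0.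
rewrite addr0.
have e1 : 0 < e / (2 * `|h|) by rewrite divr_gt0// mulr_gt0// normr_gt0.
have /cvgrPdist_lt/(_ _ e1) : v @ \oo --> u by [].
move=> [N1 _ H1]; have [N2 _ H2] := near_infty_natSinv_lt (PosNum e1).
pose n := maxn N1 N2.
have h1 : `|u - v n| < e / (2 * `|h|) := H1 n (leq_maxl _ _).
have h2 : n.+1%:R^-1 < e / (2 * `|h|) := H2 n (leq_maxr _ _).
have -> : ip u h - D h = ip (u - v n) h + (ip (v n) h - D h).
  by rewrite linearBl/=; ring.
apply: le_trans (ler_normD _ _) _.
have := normr_ip_le hip (u - v n) h; have := c n.
have hp : 0 < `|h| by rewrite normr_gt0.
have -> : e = e / (2 * `|h|) * `|h| + e / (2 * `|h|) * `|h|.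
  by field; rewrite gt_eqF.
have := ler_wpM2r (ltW hp) (ltW h1); have := ler_wpM2r (ltW hp) (ltW h2).
move=> G1 G2 G3 G4; apply: lerD; first exact: le_trans G4 G2.
exact: le_trans G3 G1.
Qed.

(** A primitive composed with the norm has, at every point [z], a supporting
    affine function from above up to the error [12 W]: the tangent inequality
    for [W] costs [4 W], and the second-order term of the norm at [z], which is
    at most [|h|^2 / (2 |z|)], costs [w |z| * |h|^2 / (2 |z|) <= 2 W |h|] as
    long as [|h| <= |z|]. For larger [h], both [|z + h| - |z|] and
    [- <z, h> / |z|] are at most [|h|], which costs [2 |h| w |h| <= 8 W |h|]. *)
Lemma primitive_norm_upper (R : realType) (w W : R -> R) (X : normedModType R)
    (ip : {dot X for idfun}) (z : X) :
  modulus_primitive w W -> induces_norm ip ->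
  exists T : X, forall x,
    W `|x| <= W `|z| + ip T (x - z) + 12 * W `|x - z|.
Proof.
move=> wW hip; have [->|z0] := eqVneq z 0.
  exists 0 => x; rewrite linear0l normr0 (mp0 wW) !add0r subr0.
  by have := primitive_ge0 wW (normr_ge0 x); lra.
exists ((w `|z| / `|z|) *: z) => x; rewrite -[x in `|x|](subrK z).
set h := x - z; rewrite linearZl_LR/=.
have a0 : 0 < `|z| by rewrite normr_gt0.
have normzh := normD_sqr hip z h.
have zh_le : - ip z h <= `|z| * `|h|.
  by have := ip_le hip (- z) h; rewrite linearNl/= normrN.
rewrite [h + z]addrC; set b := `|z + h| in normzh *; set s := `|h| in normzh zh_le *.
set a := `|z| in a0 normzh zh_le *; set q := ip z h in normzh zh_le *.
have s0 : 0 <= s := normr_ge0 _.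
have b0 : 0 <= b := normr_ge0 _.
have bas : b - a <= s by rewrite lerBlDl ler_normD.
have tangent := primitive_tangent wW (ltW a0) b0.
have Wbas : W `|b - a| <= W s.
  apply: (primitive_homo wW) => //.
  by have := ler_dist_dist (z + h) z; rewrite addrAC subrr add0r.
have wa0 := modulus_ge0 wW (ltW a0).
have sws := mul_le_primitive wW s0.
have [p qE] : exists p, q = a * p by exists (q / a); field; rewrite gt_eqF.
rewrite (_ : w a / a * q = w a * p); last by rewrite qE; field; rewrite gt_eqF.
suff : w a * (b - a - p) <= 8 * W s by lra.
have Ws0 := primitive_ge0 wW s0.
have [sa|/ltW as_] := leP s a.
  have st := mp_star wW s0 sa.
  have H : 2 * a * (b - a - p) <= s ^+ 2 by have := sqr_ge0 (b - a); nra.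
  have := ler_wpM2l wa0 H; have := ler_wpM2l s0 st.
  have := ler_wpM2l (ltW a0) sws => G1 G2 G3.
  have : a * (w a * (b - a - p)) <= a * (2 * W s) by lra.
  by rewrite ler_pM2l//; lra.
have ho := mp_homo wW (ltW a0) as_.
have ps : - p <= s.
  by rewrite -(ler_pM2l a0) mulrN -qE.
have H : b - a - p <= 2 * s by lra.
have := ler_wpM2l wa0 H; have := ler_wpM2l s0 ho; lra.
Qed.

(** * Paraconvex functions and envelopes *)

(** The factor [l * (1 - l)] is what makes a function that is paraconvex
    together with its opposite differentiable; a midpoint condition with the
    error [W `|x - y|] would be too weak for a general modulus. *)
Definition paraconvex (R : realType) (X : normedModType R) (W : R -> R) (K : R)
    (h : X -> R) : Prop :=
  forall (l : R) (x y : X), 0 <= l -> l <= 1 ->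
    h (l *: x + (1 - l) *: y) <=
      l * h x + (1 - l) * h y + K * (l * (1 - l) * W `|x - y|).

(** Average the upper supports at [z = l x + (1 - l) y]: the linear parts
    cancel, and [W ((1 - l) d) <= (1 - l) W d], [W (l d) <= l W d] produce the
    factor [l (1 - l)] twice. *)
Lemma upper_support_paraconcave (R : realType) (X : normedModType R)
    (w W : R -> R) (c : R) (h : X -> R) :
  modulus_primitive w W -> 0 <= c ->
  (forall z, exists2 T : X -> R, scalar T &
    forall x, h x <= h z + T (x - z) + c * W `|x - z|) ->
  paraconvex W (2 * c) (fun x => - h x).
Proof.
move=> wW c0 supp l x y l0 l1; set z := l *: x + (1 - l) *: y.
have [T Tlin hT] := supp z.
have l0' : 0 <= 1 - l by lra.
have l1' : 1 - l <= 1 by lra.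
have xz : x - z = (1 - l) *: (x - y).
  rewrite /z opprD addrA -{1}[x]scale1r -scalerBl -scalerBr.
  by [].
have yz : y - z = - l *: (x - y).
  rewrite /z opprD addrCA -{1}[y]scale1r -scalerBl opprB addrC subrKC.
  by rewrite scaleNr scalerBr opprB addrC.
have T0 : T 0 = 0.
  by have := Tlin 1 0 0; rewrite scale1r addr0 mul1r; lra.
have TZ a v : T (a *: v) = a * T v by rewrite -[a *: v]addr0 Tlin T0 addr0.
have := hT x; have := hT y; rewrite xz yz !TZ !normrZ normrN !ger0_norm//.
have d0 := normr_ge0 (x - y).
have := primitive_scale wW l0 l1 d0; have := primitive_scale wW l0' l1' d0.
move=> W1 W2 hy hx.
have := ler_wpM2l (mulr_ge0 c0 l0) W1; have := ler_wpM2l (mulr_ge0 c0 l0') W2.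
have := ler_wpM2l l0 hx; have := ler_wpM2l l0' hy.
lra.
Qed.

(** The affine functions corrected by [M W `|x - y|] that bound an extension
    from above and, with the opposite sign, from below. *)
Lemma cone_paraconcave (R : realType) (X : normedModType R)
    (ip : {dot X for idfun}) (w W : R -> R) (M a : R) (v y : X) :
  modulus_primitive w W -> induces_norm ip -> 0 <= M ->
  paraconvex W (24 * M) (fun x => - (a + ip v (x - y) + M * W `|x - y|)).
Proof.
move=> wW hip M0; rewrite (_ : 24 * M = 2 * (12 * M)); last by ring.
apply: (upper_support_paraconcave wW); first by rewrite mulr_ge0.
move=> z; have [T hT] := primitive_norm_upper (z - y) wW hip.
exists (fun u => ip v u + M * ip T u).
  have lin t b u u' : ip t (b *: u + u') = b * ip t u + ip t u'.
    by rewrite linearDr/= linearZr_LR.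
  by move=> b u u'; rewrite !lin; ring.
move=> x; have := hT (x - y); rewrite opprB addrA subrK => /(ler_wpM2l M0).
have -> : ip v (x - y) = ip v (z - y) + ip v (x - z).
  by rewrite -linearDr/= [z - y + _]addrC subrKA.
lra.
Qed.

Definition envelope (R : realType) (X : normedModType R) (W : R -> R) (K : R)
    (g : X -> R) (x : X) : R :=
  sup [set h x | h in [set h | paraconvex W K h /\ forall y, h y <= g y]].

Section Envelope.
Context {R : realType} {X : normedModType R} {W : R -> R} {K : R} {g : X -> R}.
Hypothesis minorant : exists2 h, paraconvex W K h & forall y, h y <= g y.

Let F := envelope W K g.

Lemma envelope_le x : F x <= g x.
Proof.
have [h hK hg] := minorant.
by apply: ge_sup => [|_ [k [_ kg] <-]//]; exists (h x), h.
Qed.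

Lemma le_envelope h x : paraconvex W K h -> (forall y, h y <= g y) -> h x <= F x.
Proof.
move=> hK hg; apply: ub_le_sup; last by exists h.
by exists (g x) => _ [k [_ kg] <-].
Qed.

Lemma envelope_paraconvex : paraconvex W K F.
Proof.
move=> l x y l0 l1; have [h0 h0K h0g] := minorant.
apply: ge_sup; first by exists (h0 (l *: x + (1 - l) *: y)), h0.
move=> _ [h [hK hg] <-]; apply: le_trans (hK l x y l0 l1) _.
have l1' : 0 <= 1 - l by lra.
rewrite lerD2r lerD// ler_wpM2l//; exact: le_envelope.
Qed.

Let combine (l : R) (u v : X) (s : X) :
  l *: u + (1 - l) *: v + s = l *: (u + s) + (1 - l) *: (v + s).
Proof.
by rewrite !scalerDr addrACA -scalerDl subrKC scale1r.
Qed.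

Let shiftB (u v s : X) : (u + s) - (v + s) = u - v.
Proof. by rewrite opprD addrACA subrr addr0. Qed.

(** The envelope inherits the upper bound of [g]: averaging two translates of
    the envelope, and subtracting the error, produces a competitor. *)
Lemma envelope_paraconcave :
  paraconvex W K (fun x => - g x) -> paraconvex W K (fun x => - F x).
Proof.
move=> gK l x y l0 l1; have l1' : 0 <= 1 - l by lra.
set z := l *: x + (1 - l) *: y.
pose H u := l * F (u + (x - z)) + (1 - l) * F (u + (y - z))
            - K * (l * (1 - l) * W `|x - y|).
have HK : paraconvex W K H.
  move=> a u v a0 a1; rewrite /H !combine.
  have := envelope_paraconvex (u + (x - z)) (v + (x - z)) a0 a1.
  have := envelope_paraconvex (u + (y - z)) (v + (y - z)) a0 a1.
  rewrite !shiftB => /(ler_wpM2l l1') G1 /(ler_wpM2l l0) G2.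
  rewrite -/F in G1 G2; lra.
have Hg u : H u <= g u.
  have := gK l (u + (x - z)) (u + (y - z)) l0 l1.
  have -> : u + (x - z) - (u + (y - z)) = x - y.
    by rewrite ![u + _]addrC shiftB shiftB.
  have -> : l *: (u + (x - z)) + (1 - l) *: (u + (y - z)) = u.
    rewrite ![u + _]addrC -combine addrC -[RHS]addr0; congr (_ + _).
    rewrite !scalerBr addrACA -opprD -scalerDl subrKC scale1r subrr.
    by [].
  have := ler_wpM2l l0 (envelope_le (u + (x - z))).
  have := ler_wpM2l l1' (envelope_le (u + (y - z))).
  rewrite /H; lra.
have := le_envelope z HK Hg; rewrite /H !subrKC; lra.
Qed.

(** The competitor is the translate of the envelope by [x - y], lowered by
    [L |x - y|]. *)
Lemma envelope_lipschitz (L : R) :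
  (forall x y, g x - g y <= L * `|x - y|) ->
  forall x y, F x - F y <= L * `|x - y|.
Proof.
move=> gL x y; pose H u := F (u + (x - y)) - L * `|x - y|.
have HK : paraconvex W K H.
  move=> a u v a0 a1; rewrite /H combine.
  have := envelope_paraconvex (u + (x - y)) (v + (x - y)) a0 a1.
  rewrite shiftB -/F; lra.
have Hg u : H u <= g u.
  have := envelope_le (u + (x - y)); have := gL (u + (x - y)) u.
  by rewrite addrAC subrr add0r /H; lra.
by have := le_envelope y HK Hg; rewrite /H subrKC; lra.
Qed.

End Envelope.

(** * Differentiability of two-sided paraconvex functions *)

(** Used in place of limits of difference quotients: an inequality that holds at
    all scales [s] up to an error [o(s)] holds exactly. *)
Lemma primitive_negligible (R : realType) (w W : R -> R) (C r a b : R) :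
  modulus_primitive w W -> 0 <= C -> 0 <= r ->
  (forall s, 0 < s -> s * a <= s * b + C * W (s * r)) -> a <= b.
Proof.
move=> wW C0 r0 H; rewrite leNgt; apply/negP => ba.
have C1 : 0 < C + 1 by lra.
have e0 : 0 < (a - b) / (C + 1) by rewrite divr_gt0// subr_gt0.
have [d d0 /(_ d d0 (lexx d)) Wd] := primitive_small wW r0 e0.
have := H d d0; have := ler_wpM2l C0 Wd.
have -> : C * (d * ((a - b) / (C + 1))) = d * (a - b) - d * ((a - b) / (C + 1)).
  by field; rewrite gt_eqF.
have := mulr_gt0 d0 e0; lra.
Qed.

Section Taylor.
Context {R : realType} {w W : R -> R} {X : normedModType R} {K : R} {F : X -> R}.
Hypothesis wW : modulus_primitive w W.
Hypothesis K0 : 0 <= K.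
Hypothesis F_convex : paraconvex W K F.
Hypothesis F_concave : paraconvex W K (fun x => - F x).
Variable x : X.

Let dF v := F (x + v) - F x.

Let W_ge0 (s : R) (v : X) : 0 <= s -> 0 <= K * W (s * `|v|).
Proof. by move=> s0; rewrite mulr_ge0// (primitive_ge0 wW)// mulr_ge0. Qed.

Let scaled t v : 0 <= t -> t <= 1 ->
  dF (t *: v) <= t * dF v + K * (t * W `|v|) /\
  t * dF v <= dF (t *: v) + K * (t * W `|v|).
Proof.
move=> t0 t1; have := F_convex (x + v) x t0 t1; have := F_concave (x + v) x t0 t1.
have -> : t *: (x + v) + (1 - t) *: x = x + t *: v.
  by rewrite scalerDr addrAC -scalerDl subrKC scale1r.
rewrite [x + v - x]addrAC subrr add0r.
have W0 := primitive_ge0 wW (normr_ge0 v).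
have : K * (t * (1 - t) * W `|v|) <= K * (t * W `|v|).
  rewrite ler_wpM2l// ler_wpM2r// ler_piMr//; lra.
rewrite /dF; split; lra.
Qed.

(** The lower bounds for the slope of [F] at [x] in the direction [v] given by
    the steps [s]. *)
Let slopes v := [set (dF (s *: v) - K * W (s * `|v|)) / s | s in [set s | 0 < s]].

(** The derivative as a supremum: every lower bound lies below every upper
    bound, so that no limit has to be taken. *)
Let D v := sup (slopes v).

Let slopes_le s s' v : 0 < s -> 0 < s' ->
  (dF (s *: v) - K * W (s * `|v|)) / s <= (dF (s' *: v) + K * W (s' * `|v|)) / s'.
Proof.
move=> s0 s'0; rewrite ler_pdivrMr// mulrAC ler_pdivlMr//.
have [ss'|/ltW ss'] := leP s s'.
- have t0 : 0 <= s / s' by rewrite divr_ge0// ltW.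
  have t1 : s / s' <= 1 by rewrite ler_pdivrMr// mul1r.
  have [] := scaled (s' *: v) t0 t1.
  rewrite scalerA divfK ?gt_eqF// normrZ gtr0_norm// => + _.
  move=> /(ler_wpM2l (ltW s'0)).
  have := mulr_ge0 (ltW s'0) (W_ge0 v (ltW s0)).
  have -> : s' * (s / s' * dF (s' *: v) + K * (s / s' * W (s' * `|v|))) =
    s * (dF (s' *: v) + K * W (s' * `|v|)) by field; rewrite gt_eqF.
  lra.
- have t0 : 0 <= s' / s by rewrite divr_ge0// ltW.
  have t1 : s' / s <= 1 by rewrite ler_pdivrMr// mul1r.
  have [_] := scaled (s *: v) t0 t1.
  rewrite scalerA divfK ?gt_eqF// normrZ gtr0_norm//.
  move=> /(ler_wpM2l (ltW s0)).
  have := mulr_ge0 (ltW s0) (W_ge0 v (ltW s'0)).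
  have -> : s * (s' / s * dF (s *: v)) = s' * dF (s *: v).
    by field; rewrite gt_eqF.
  have -> : s * (dF (s' *: v) + K * (s' / s * W (s * `|v|))) =
    s * dF (s' *: v) + s' * (K * W (s * `|v|)) by field; rewrite gt_eqF.
  lra.
Qed.

Let expansion s v : 0 < s ->
  dF (s *: v) <= s * D v + K * W (s * `|v|) /\
  s * D v <= dF (s *: v) + K * W (s * `|v|).
Proof.
move=> s0; split.
  rewrite -lerBlDr -ler_pdivrMl// mulrC; apply: ub_le_sup; last by exists s.
  exists ((dF (s *: v) + K * W (s * `|v|)) / s) => _ [s' s'0 <-].
  exact: slopes_le.
rewrite -ler_pdivlMl// mulrC; apply: ge_sup.
  by exists ((dF (1 *: v) - K * W (1 * `|v|)) / 1), 1 => //=; exact: ltr01.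
by move=> _ [s' s'0 <-]; exact: slopes_le.
Qed.

Let W_le (s r r' : R) : 0 < s -> 0 <= r -> r <= r' -> K * W (s * r) <= K * W (s * r').
Proof.
move=> s0 r0 rr'; rewrite ler_wpM2l// (primitive_homo wW)//.
  by rewrite mulr_ge0// ltW.
by rewrite ler_wpM2l// ltW.
Qed.

Let D_scale t v : 0 < t -> D (t *: v) = t * D v.
Proof.
move=> t0; have K2 : 0 <= 2 * K by rewrite mulr_ge0.
have r0 : 0 <= t * `|v| by rewrite mulr_ge0// ltW.
have step s : 0 < s -> s * D (t *: v) <= s * (t * D v) + 2 * K * W (s * (t * `|v|)) /\
    s * (t * D v) <= s * D (t *: v) + 2 * K * W (s * (t * `|v|)).
  move=> s0; have [] := expansion (t *: v) s0; have [] := expansion v (mulr_gt0 s0 t0).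
  rewrite scalerA normrZ gtr0_norm// !mulrA => *; split; lra.
apply/eqP; rewrite eq_le; apply/andP; split;
  by apply: (primitive_negligible wW K2 r0) => s /step[].
Qed.

(** Additivity: on the segment from [x + s u] to [x + s v] the midpoint defect
    of [F] is at most [K W (s |u - v|)], which is [o(s)]. *)
Let D_mid u v : D u + D v = 2 * D (2^-1 *: (u + v)).
Proof.
pose r := `|u| + `|v|; have r0 : 0 <= r by rewrite addr_ge0.
have ur : `|u| <= r by rewrite lerDl.
have vr : `|v| <= r by rewrite lerDr.
have mr : `|2^-1 *: (u + v)| <= r.
  rewrite normrZ gtr0_norm ?invr_gt0//; have := ler_normD u v; rewrite -/r; lra.
have uvr : `|u - v| <= r by rewrite /r -(normrN v) ler_normD.
have K5 : 0 <= 5 * K by rewrite mulr_ge0.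
have h0 : 0 <= 2^-1 :> R by rewrite invr_ge0.
have h1 : 2^-1 <= 1 :> R by rewrite invf_le1// ler1n.
have step s : 0 < s ->
    s * (D u + D v) <= s * (2 * D (2^-1 *: (u + v))) + 5 * K * W (s * r) /\
    s * (2 * D (2^-1 *: (u + v))) <= s * (D u + D v) + 5 * K * W (s * r).
  move=> s0; have [] := expansion u s0; have [] := expansion v s0.
  have [] := expansion (2^-1 *: (u + v)) s0.
  have := W_le s0 (normr_ge0 _) ur; have := W_le s0 (normr_ge0 _) vr.
  have := W_le s0 (normr_ge0 _) mr; have := W_le s0 (normr_ge0 _) uvr.
  have := F_convex (x + s *: u) (x + s *: v) h0 h1.
  have := F_concave (x + s *: u) (x + s *: v) h0 h1.
  have -> : 1 - 2^-1 = 2^-1 :> R by lra.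
  have -> : 2^-1 *: (x + s *: u) + 2^-1 *: (x + s *: v) =
      x + s *: (2^-1 *: (u + v)).
    have hh : 2^-1 + 2^-1 = 1 :> R by lra.
    by rewrite !scalerDr addrACA -scalerDl hh scale1r !scalerA [s * _]mulrC.
  have -> : x + s *: u - (x + s *: v) = s *: (u - v).
    by rewrite opprD addrACA subrr add0r scalerBr.
  rewrite (normrZ s (u - v)) gtr0_norm//.
  have := W_ge0 (u - v) (ltW s0).
  rewrite /dF => *; split; lra.
apply/eqP; rewrite eq_le; apply/andP; split;
  by apply: (primitive_negligible wW K5 r0) => s /step[].
Qed.

Let D_add u v : D (u + v) = D u + D v.
Proof.
have h0 : 0 < 2^-1 :> R by rewrite invr_gt0.
by rewrite D_mid (D_scale _ h0) mulrA divff// mul1r.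
Qed.

Let D_scalar : scalar D.
Proof.
move=> a u v; rewrite D_add; congr (_ + _).
have D0 : D 0 = 0 by have := D_add 0 0; rewrite addr0; lra.
have DN z : D (- z) = - D z by have := D_add z (- z); rewrite subrr D0; lra.
have [a0|a0|->] := ltgtP a 0; last by rewrite scale0r mul0r.
  rewrite -[a]opprK scaleNr DN D_scale ?oppr_gt0//; ring.
exact: D_scale.
Qed.

Lemma paraconvex_expansion (L : R) : (forall y z, F y - F z <= L * `|y - z|) ->
  exists D : X -> R, [/\ scalar D, forall v, D v <= L * `|v| &
    forall v, `|F (x + v) - F x - D v| <= K * W `|v|].
Proof.
move=> FL; exists D; split; first exact: D_scalar.
- move=> v; apply: (primitive_negligible wW K0 (normr_ge0 v)) => s s0.
  have [_] := expansion v s0; have := FL (x + s *: v) x.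
  rewrite -/(dF (s *: v)) [_ + _ - x]addrAC subrr add0r normrZ gtr0_norm//; lra.
- move=> v; have [] := expansion v ltr01.
  rewrite scale1r !mul1r ler_norml -/(dF v) => h1 h2; apply/andP; split; lra.
Qed.

End Taylor.

Lemma paraconvex_gradient (R : realType) (w W : R -> R)
    (X : completeNormedModType R) (ip : {dot X for idfun}) (K L : R) (F : X -> R) :
  modulus_primitive w W -> induces_norm ip -> 0 <= K ->
  paraconvex W K F -> paraconvex W K (fun x => - F x) ->
  (forall y z, F y - F z <= L * `|y - z|) ->
  exists T : X -> X, forall x v, `|F (x + v) - F x - ip (T x) v| <= K * W `|v|.
Proof.
move=> wW hip K0 Fcvx Fccv FL.
have ex x : exists u : X, forall v, `|F (x + v) - F x - ip u v| <= K * W `|v|.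
  have [D [Dlin DL DF]] := paraconvex_expansion wW K0 Fcvx Fccv x FL.
  have [u uE] := riesz hip Dlin DL.
  by exists u => v; rewrite -uE.
by exists (fun x => projT1 (cid (ex x))) => x; case: cid.
Qed.

(** * First-order expansions and gradients *)

Section Expansion.
Context {R : realType} {w W : R -> R} {X : completeNormedModType R}.
Context {ip : {dot X for idfun}} {K : R}.
Hypothesis wW : modulus_primitive w W.
Hypothesis hip : induces_norm ip.
Hypothesis K0 : 0 <= K.

(** This determines ['d F x], which is defined by a choice, and makes the
    gradient computable. *)
Lemma expansion_diff (F : X -> R) (x u : X) :
  (forall v, `|F (x + v) - F x - ip u v| <= K * W `|v|) ->
  differentiable F x /\ 'd F x = ip u :> (X -> R).
Proof.
move=> FT.
have ulin : linear (ip u : X -> R).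
  by move=> a v v'; rewrite linearDr/= linearZr_LR.
pose ulM := GRing.isLinear.Build _ _ _ _ _ ulin.
pose uL : {linear X -> R} := HB.pack (ip u : X -> R) ulM.
have uc : continuous uL.
  apply: bounded_linear_continuous; apply/linear_boundedP.
  exists `|u|; split; first exact: num_real.
  move=> r ur v; apply: le_trans (normr_ip_le hip u v) _.
  by rewrite ler_wpM2r// ltW.
have o : F \o shift x = cst (F x) + uL +o_ 0 id.
  apply/eqaddoP => e e0.
  have [d d0 wd] := mp_small wW (divr_gt0 e0 (ltr_wpDl K0 (@ltr01 R))).
  near=> v.
  have vd : `|v| <= d by near: v; apply: nbhs0_le.
  have vW : W `|v| <= e / (K + 1) * `|v|.
    apply: le_trans (primitive_le_mul wW (normr_ge0 v)) _.
    by rewrite mulrC ler_wpM2r// wd.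
  rewrite -[leLHS]/(`|F (v + x) - (F x + ip u v)|) [v + x]addrC opprD addrA.
  apply: le_trans (FT v) _.
  apply: le_trans (ler_wpM2l K0 vW) _; rewrite mulrA ler_wpM2r//.
  rewrite mulrA ler_pdivrMr ?ltr_wpDl// mulrDr mulr1 mulrC lerDl ltW//.
have dE : 'd F x = uL :> (X -> R) by exact: diff_unique.
split; last exact: dE.
by apply/diff_locallyP; rewrite dE; split.
Unshelve. all: by end_near.
Qed.

Lemma grad_eq (F : X -> R) (x u : X) : 'd F x = ip u :> (X -> R) -> grad ip F x = u.
Proof.
move=> dF; apply: (ip_inj hip) => h; rewrite -dF /grad.
case: xgetP => [v _ vP|/(_ u) nu]; first by rewrite vP.
by exfalso; apply: nu => k; rewrite dF.
Qed.

Lemma gradP (F : X -> R) (x h : X) : differentiable F x ->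
  'd F x h = ip (grad ip F x) h.
Proof.
move=> dF; have /linear_lipschitz[k _ kF] := diff_continuous dF.
have [|v|u uE] := @riesz _ _ ip ('d F x) k hip.
- by move=> a u v; rewrite linearP.
- exact: le_trans (ler_norm _) (kF v).
by rewrite (@grad_eq _ _ u)//; apply/funext.
Qed.

(** Take [v] of length [|x - y|] along [T x - T y]: expanding [F (x + v)] both
    at [x] and at [y] determines [<T x - T y, v>] up to errors [W |x - y|]
    (twice) and [W (2 |x - y|)]. *)
Lemma expansion_modulus (F : X -> R) (T : X -> X) :
  (forall x v, `|F (x + v) - F x - ip (T x) v| <= K * W `|v|) ->
  forall x y, `|T x - T y| <= 6 * K * w `|x - y|.
Proof.
move=> FT x y; have [->|xy] := eqVneq (T x) (T y).
  by rewrite subrr normr0 !mulr_ge0// (modulus_ge0 wW).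
set r := `|x - y|; have r0 : 0 <= r := normr_ge0 _.
have n0 : 0 < `|T x - T y| by rewrite normr_gt0 subr_eq0.
pose v := (r / `|T x - T y|) *: (T x - T y).
have vr : `|v| = r.
  by rewrite normrZ normf_div !normr_id divfK// gt_eqF.
have ipv : ip (T x - T y) v = r * `|T x - T y|.
  rewrite linearZr_LR/= hip expr2 mulrA divfK ?gt_eqF//.
have h1 := FT x v; have := FT y (x - y + v); have := FT y (x - y).
rewrite subrKC addrA subrKC linearDr/= -/r => h2 h3.
have : W `|x - y + v| <= W (2 * r).
  apply: (primitive_homo wW) => //; apply: le_trans (ler_normD _ _) _.
  by rewrite vr -/r; lra.
have Wr := primitive_le_mul wW r0; have W2r := primitive_double wW r0 => h4.
have := ler_wpM2l K0 Wr; have := ler_wpM2l K0 (le_trans h4 W2r).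
move: h1 h2 h3; rewrite vr !ler_norml => /andP[a1 a2] /andP[a3 a4] /andP[a5 a6].
move=> G1 G2.
have : r * `|T x - T y| <= r * (6 * K * w r).
  by rewrite -ipv linearBl/=; lra.
have [r00|] := eqVneq r 0.
  move=> _; exfalso; move/eqP: xy; apply; congr T.
  by apply/eqP; rewrite -subr_eq0 -normr_eq0 -/r r00.
by move=> rn0; rewrite ler_pM2l// lt_neqAle eq_sym rn0.
Qed.

End Expansion.

(** By the mean value theorem the left-hand side is the pairing of [v] with the
    difference of the gradients at [x] and at a point of the segment from [x] to
    [x + v]. *)
Lemma grad_modulus_expansion (R : realType) (w : R -> R)
    (X : completeNormedModType R) (ip : {dot X for idfun}) (K : R) (F : X -> R) :
  induces_norm ip -> 0 <= K -> (forall s t, 0 <= s -> s <= t -> w s <= w t) ->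
  (forall x, differentiable F x) ->
  (forall x y, `|grad ip F x - grad ip F y| <= K * w `|x - y|) ->
  forall x v, `|F (x + v) - F x - ip (grad ip F x) v| <= K * (`|v| * w `|v|).
Proof.
move=> hip K0 wh dF gradF x v.
pose g (t : R) := x + t *: v.
have dg (t : R) : is_diff t g (fun h => h *: v).
  have : is_diff t (cst x + *:%R^~ v) (0 + *:%R^~ v) by exact: is_diffD.
  by rewrite add0r.
have dFg (t : R) : differentiable (F \o g) t.
  by apply: differentiable_comp => //; exact: ex_diff.
have dd (t : R) : t \in `]0, 1[ -> is_derive t 1 (F \o g) ('d F (g t) v).
  move=> _; apply: DeriveDef; first exact: diff_derivable.
  by rewrite deriveE// diff_comp//= diff_val scale1r.
have cg : {within `[0, 1], continuous (F \o g)}.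
  by apply: continuous_subspaceT => t; apply: differentiable_continuous.
have [c c01] := MVT_segment ler01 dd cg.
rewrite /= /g scale1r scale0r addr0 subr0 mulr1 => ->.
move: c01; rewrite in_itv/= => /andP[c0 c1].
rewrite (gradP hip)// -linearBl/=; apply: le_trans (normr_ip_le hip _ _) _.
rewrite mulrC mulrCA ler_wpM2l//; apply: le_trans (gradF _ _) _.
rewrite ler_wpM2l//; apply: wh; first exact: normr_ge0.
by rewrite [x + _]addrC addrK normrZ ger0_norm// ler_piMl.
Qed.

(** Compare the increments of [F] in the direction [u] with their expansion. *)
Lemma grad_le_lipschitz (R : realType) (w W : R -> R) (X : normedModType R)
    (ip : {dot X for idfun}) (K L : R) (F : X -> R) (x u : X) :
  modulus_primitive w W -> induces_norm ip -> 0 <= K -> 0 <= L ->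
  (forall y z, F y - F z <= L * `|y - z|) ->
  (forall v, `|F (x + v) - F x - ip u v| <= K * W `|v|) -> `|u| <= L.
Proof.
move=> wW hip K0 L0 FL Fx; have [->|u0] := eqVneq u 0; first by rewrite normr0.
have n0 : 0 < `|u| by rewrite normr_gt0.
rewrite -(ler_pM2r n0) -expr2 -hip.
apply: (primitive_negligible wW K0 (ltW n0)) => s s0.
have := Fx (s *: u); have := FL (x + s *: u) x.
rewrite [_ + _ - x]addrAC subrr add0r linearZr_LR/= normrZ gtr0_norm//.
by move=> h1; rewrite ler_norml => /andP[h2 _]; lra.
Qed.

(** * The seminorms of a jet *)

(** By [mp_star], a nonpositive value at [t > 0] would make [omega]
    nonpositive beyond [t], against its unboundedness. *)
Lemma moc_gt0 (R : realType) (omega : R -> R) (t : R) :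
  modulus_of_continuity omega -> 0 < t -> 0 < omega t.
Proof.
move=> mo t0; rewrite ltNge; apply/negP => wt.
have /cvgryPge/(_ 1) w1 := moc_unbounded mo.
have : \forall s \near +oo, t <= s /\ 1 <= omega s.
  by apply: filterI => //; by apply: nbhs_pinfty_ge; exact: num_real.
move=> /filter_ex[s [ts ws]].
have := mp_star (moc_primitive mo) (ltW t0) ts.
have : s * omega t <= 0 by apply: mulr_ge0_le0 => //; exact: le_trans (ltW t0) ts.
have := ler_wpM2l (ltW t0) ws; lra.
Qed.

Lemma phi_gt0 (R : realType) (omega : R -> R) (t : R) :
  modulus_of_continuity omega -> 0 < t -> 0 < phi omega t.
Proof.
move=> mo t0; have := mul_le_primitive (moc_primitive mo) (ltW t0).
have := mulr_gt0 t0 (moc_gt0 mo t0); lra.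
Qed.

Section Seminorms.
Context {R : realType} {X : completeNormedModType R} {ip : {dot X for idfun}}.
Context {E : set X}.

(** A common first-order expansion of [F] at the points of [E] compares any two
    of the affine functions of the jet, by the triangle inequality through
    [F x]. *)
Lemma jetA_le (omega : R -> R) (f F : X -> R) (G : X -> X) (K : R) :
  (forall t, 0 <= t -> 0 <= phi omega t) -> 0 <= K ->
  (forall y v, E y -> `|F (y + v) - f y - ip (G y) v| <= K * phi omega `|v|) ->
  (jetA ip omega E f G <= K%:E)%E.
Proof.
move=> phi0 K0 FE; apply: ge_ereal_sup => _ [->|[x [y [z [Ey Ez _ ->]]]]] /=.
  by rewrite lee_fin.
rewrite lee_fin; set d := (X in _ / X).
have [->|dn0] := eqVneq d 0; first by rewrite invr0 mulr0.
have d0 : 0 < d by rewrite lt_neqAle eq_sym dn0 addr_ge0// phi0.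
rewrite ler_pdivrMr//.
have := FE y (x - y) Ey; have := FE z (x - z) Ez; rewrite !subrKC /d mulrDr.
set p := _ * phi _ _; set q := _ * phi _ _.
rewrite !ler_norml => /andP[h1 h2] /andP[h3 h4]; apply/andP; split; lra.
Qed.

Lemma jetA_fin (omega : R -> R) (f : X -> R) (G : X -> X) :
  modulus_of_continuity omega -> (jetA ip omega E f G < +oo)%E ->
  exists A : R, [/\ 0 <= A, jetA ip omega E f G = A%:E &
    forall x y z, E y -> E z ->
      f z + ip (G z) (x - z) - f y - ip (G y) (x - y) <=
        A * (phi omega `|x - z| + phi omega `|x - y|)].
Proof.
move=> mo Afin; have A0 : (0 <= jetA ip omega E f G)%E.
  by apply: ereal_sup_ubound; left.
have Afn : jetA ip omega E f G \is a fin_num by rewrite ge0_fin_numE.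
exists (fine (jetA ip omega E f G)); split.
- exact: fine_ge0.
- by rewrite fineK.
- move=> x y z Ey Ez; have wW := moc_primitive mo.
  have [d0|] := ltP 0 (`|x - z| + `|x - y|); last first.
    move=> d0; have xz : `|x - z| = 0.
      by have := normr_ge0 (x - z); have := normr_ge0 (x - y); lra.
    have xy : `|x - y| = 0.
      by have := normr_ge0 (x - z); have := normr_ge0 (x - y); lra.
    move/eqP: xz xy; rewrite normr_eq0 subr_eq0 => /eqP <- /eqP.
    rewrite normr_eq0 subr_eq0 => /eqP <-.
    by rewrite subrr !normr0 (mp0 wW) !linear0r !addr0 mulr0 subrr subr0.
  have phi0 u : 0 <= phi omega `|u : X| by exact: (primitive_ge0 wW).
  have p0 : 0 < phi omega `|x - z| + phi omega `|x - y|.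
    have [xz|xz] := eqVneq (`|x - z|) 0.
      by rewrite ltr_wpDl// phi_gt0//; lra.
    by rewrite ltr_pwDl// phi_gt0// lt_neqAle eq_sym xz/=.
  rewrite -ler_pdivrMr// -lee_fin fineK//.
  apply: (@le_trans _ _ (`|f z + ip (G z) (x - z) - f y - ip (G y) (x - y)|
    / (phi omega `|x - z| + phi omega `|x - y|))%:E).
    by rewrite lee_fin ler_pM2r ?invr_gt0// ler_norm.
  by apply: ereal_sup_ubound; right; exists x, z, y.
Qed.

Lemma Lip_fin (f : X -> R) : E !=set0 -> [lipschitz f x | x in E] ->
  exists L : R, [/\ 0 <= L, Lip E f = L%:E &
    forall x y, E x -> E y -> f x - f y <= L * `|x - y|].
Proof.
move=> [x0 Ex0] fL.
have [k [k0 kL]] : exists k : R, 0 <= k /\ k.-lipschitz_E f.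
  have /pinfty_ex_gt0[k k0 kL] := fL; exists k; split; [exact: ltW|exact: kL].
have L0 : (0 <= Lip E f)%E.
  by apply: le_ereal_inf_tmp => _ [l [l0 _] <-]; rewrite lee_fin.
have Lk : (Lip E f <= k%:E)%E by apply: ereal_inf_lbound; exists k.
have Lfn : Lip E f \is a fin_num by rewrite ge0_fin_numE// (le_lt_trans Lk)// ltry.
exists (fine (Lip E f)); split; [exact: fine_ge0|by rewrite fineK|].
move=> x y Ex Ey; have [->|xy] := eqVneq x y; first by rewrite !subrr normr0 mulr0.
have xy0 : 0 < `|x - y| by rewrite normr_gt0 subr_eq0.
rewrite -ler_pdivrMr// -lee_fin fineK//.
apply: le_ereal_inf_tmp => _ [l [l0 lf] <-]; rewrite lee_fin ler_pdivrMr//.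
exact: le_trans (ler_norm _) (lf (x, y) (conj Ex Ey)).
Qed.

Lemma lipschitz_le (f : X -> R) (L : R) :
  (forall x y, E x -> E y -> f x - f y <= L * `|x - y|) -> L.-lipschitz_E f.
Proof.
move=> fL [x y] [/= Ex Ey]; rewrite ler_norml fL// andbT lerNl opprB distrC.
exact: fL.
Qed.

Lemma Lip_le (f : X -> R) (L : R) : 0 <= L ->
  (forall x y, E x -> E y -> f x - f y <= L * `|x - y|) -> (Lip E f <= L%:E)%E.
Proof.
move=> L0 fL; apply: ereal_inf_lbound; exists L => //; split=> //.
exact: lipschitz_le.
Qed.

Lemma supnorm_fin (G : X -> X) : E !=set0 -> [bounded G x | x in E] ->
  exists B : R, [/\ 0 <= B, supnorm E G = B%:E & forall y, E y -> `|G y| <= B].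
Proof.
move=> [x0 Ex0] /pinfty_ex_gt0[k k0 kG].
have kB : (supnorm E G <= k%:E)%E.
  by apply: ge_ereal_sup => _ [y Ey <-]; rewrite lee_fin; exact: kG.
have B_ge y : E y -> (`|G y|%:E <= supnorm E G)%E.
  by move=> Ey; apply: ereal_sup_ubound; exists y.
have B0 : (0 <= supnorm E G)%E by apply: le_trans (B_ge _ Ex0); rewrite lee_fin.
have Bfn : supnorm E G \is a fin_num.
  by rewrite ge0_fin_numE// (le_lt_trans kB)// ltry.
exists (fine (supnorm E G)); split; [exact: fine_ge0|by rewrite fineK|].
by move=> y Ey; rewrite -lee_fin fineK// B_ge.
Qed.

End Seminorms.

(** * The extension *)

Section Extension.
Context {R : realType} {w W : R -> R} {X : completeNormedModType R}.
Context {ip : {dot X for idfun}} {E : set X} {f : X -> R} {G : X -> X}.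
Context {A L B : R}.
Hypothesis wW : modulus_primitive w W.
Hypothesis W1 : 0 < W 1.
Hypothesis hip : induces_norm ip.
Hypothesis E0 : E !=set0.
Hypotheses (A0 : 0 <= A) (L0 : 0 <= L) (B0 : 0 <= B).
Hypothesis fL : forall x y, E x -> E y -> f x - f y <= L * `|x - y|.
Hypothesis GB : forall y, E y -> `|G y| <= B.
Hypothesis fGA : forall x y z, E y -> E z ->
  f z + ip (G z) (x - z) - f y - ip (G y) (x - y) <=
    A * (W `|x - z| + W `|x - y|).

Let psi := truncW w W.
Let psiP : modulus_primitive (truncw w) psi := truncated_modulus_primitive wW.
(** [A] serves the pairs of distances at most [1], [2 (L + B) / W 1] the others,
    see [truncated_jet]. *)
Let M := A + 2 / W 1 * (L + B).

Let M0 : 0 <= M.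
Proof. by rewrite addr_ge0// mulr_ge0 ?addr_ge0// divr_ge0// ltW. Qed.

Let psi0 (u : X) : 0 <= psi `|u|.
Proof. exact: (primitive_ge0 psiP). Qed.

(** Where the truncated primitive differs from [W], the Lipschitz bounds take
    over: the jet varies at most linearly and the truncation grows linearly. *)
Let truncated_jet x y z : E y -> E z ->
  f z + ip (G z) (x - z) - f y - ip (G y) (x - y) <=
    M * (psi `|x - z| + psi `|x - y|).
Proof.
move=> Ey Ez; have pz := psi0 (x - z); have py := psi0 (x - y).
have LBM : 0 <= 2 / W 1 * (L + B).
  by rewrite mulr_ge0 ?addr_ge0// divr_ge0// ltW.
have [/andP[xz xy]|] := boolP ((`|x - z| <= 1) && (`|x - y| <= 1)).
  have := fGA x Ey Ez; rewrite /M /psi /truncW xz xy.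
  move: pz py; rewrite /psi /truncW xz xy.
  move=> pz py; have := mulr_ge0 LBM (addr_ge0 pz py); lra.
move=> far.
have lin : f z + ip (G z) (x - z) - f y - ip (G y) (x - y) <=
    (L + B) * (`|x - z| + `|x - y|).
  have h1 := fL Ez Ey; have h2 := ip_le hip (G z) (x - z).
  have h3 := ip_le hip (- G y) (x - y); rewrite linearNl/= normrN in h3.
  have h4 := ler_wpM2r (normr_ge0 (x - z)) (GB Ez).
  have h5 := ler_wpM2r (normr_ge0 (x - y)) (GB Ey).
  have h6 : `|z - y| <= `|x - z| + `|x - y|.
    by rewrite (distrC x z) -(subrKA x z) ler_normD.
  have := ler_wpM2l L0 h6; lra.
have half s t : 1 <= s -> 0 <= t -> t <= s -> (s + t) <= 2 / W 1 * psi s.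
  move=> s1 t0 ts; have := truncW_linear wW s1; rewrite -/psi => h.
  rewrite -mulrA mulrCA ler_pdivlMl//; have := ler_wpM2l (ltW W1) ts; lra.
have sum : `|x - z| + `|x - y| <= 2 / W 1 * (psi `|x - z| + psi `|x - y|).
  have c0 : 0 <= 2 / W 1 by rewrite divr_ge0// ltW.
  have := mulr_ge0 c0 pz; have := mulr_ge0 c0 py.
  have [zy|/ltW yz] := leP `|x - z| `|x - y|.
    have y1 : 1 <= `|x - y|.
      rewrite leNgt; apply/negP => y1; move: far.
      by rewrite (ltW y1) (le_trans zy (ltW y1)).
    have := half _ _ y1 (normr_ge0 (x - z)) zy; lra.
  have z1 : 1 <= `|x - z|.
    rewrite leNgt; apply/negP => z1; move: far.
    by rewrite (ltW z1) (le_trans yz (ltW z1)).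
  have := half _ _ z1 (normr_ge0 (x - y)) yz; lra.
apply: le_trans lin _; apply: le_trans (ler_wpM2l (addr_ge0 L0 B0) sum) _.
by rewrite mulrCA mulrA ler_wpM2r ?addr_ge0// lerDr.
Qed.

Let cone y x := f y + ip (G y) (x - y) + M * psi `|x - y|.

Let g x := inf [set cone y x | y in E].

Let minorant_cone z x y : E z -> E y ->
  f z + ip (G z) (x - z) - M * psi `|x - z| <= cone y x.
Proof. by move=> Ez Ey; have := truncated_jet x Ey Ez; rewrite /cone; lra. Qed.

Let le_g z x : E z -> f z + ip (G z) (x - z) - M * psi `|x - z| <= g x.
Proof.
move=> Ez; apply: lb_le_inf; first by exists (cone z x), z.
by move=> _ [y Ey <-]; exact: minorant_cone.
Qed.

Let g_le y x : E y -> g x <= cone y x.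
Proof.
move=> Ey; apply: ge_inf; last by exists y.
exists (f y + ip (G y) (x - y) - M * psi `|x - y|) => _ [z Ez <-].
exact: minorant_cone.
Qed.

Let g_ge x b : (forall y, E y -> b <= cone y x) -> b <= g x.
Proof.
move=> H; have [y0 Ey0] := E0.
by apply: lb_le_inf; [exists (cone y0 x), y0|move=> _ [y Ey <-]; exact: H].
Qed.

Let K := 24 * M.

Let g_paraconcave : paraconvex psi K (fun x => - g x).
Proof.
move=> l x y l0 l1; have l1' : 0 <= 1 - l by lra.
suff : l * g x + (1 - l) * g y - K * (l * (1 - l) * psi `|x - y|) <=
  g (l *: x + (1 - l) *: y) by lra.
apply: g_ge => u Eu.
have := cone_paraconcave (f u) (G u) u psiP hip M0 x y l0 l1.
have := ler_wpM2l l0 (g_le x Eu); have := ler_wpM2l l1' (g_le y Eu).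
rewrite /cone /K; lra.
Qed.

Let g_lipschitz x y : g x - g y <= (B + M * w 1) * `|x - y|.
Proof.
suff : g x - (B + M * w 1) * `|x - y| <= g y by lra.
apply: g_ge => u Eu; have := g_le x Eu; rewrite /cone.
have -> : x - u = (x - y) + (y - u) by rewrite subrKA.
rewrite linearDr/= => h1.
have := ip_le hip (G u) (x - y).
have := ler_wpM2r (normr_ge0 (x - y)) (GB Eu).
have h2 : psi `|x - y + (y - u)| - psi `|y - u| <= w 1 * `|x - y|.
  apply: le_trans (truncW_lipschitz wW _ _) _ => //.
  rewrite ler_wpM2l ?(modulus_ge0 wW)//.
  by have := ler_dist_dist (x - y + (y - u)) (y - u); rewrite addrK.
have := ler_wpM2l M0 h2; lra.
Qed.

Let minorant : exists2 h, paraconvex psi K h & forall x, h x <= g x.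
Proof.
have [z Ez] := E0.
exists (fun x => f z + ip (G z) (x - z) - M * psi `|x - z|).
  move=> l x y l0 l1.
  have := cone_paraconcave (- f z) (- G z) z psiP hip M0 x y l0 l1.
  rewrite !linearNl/= /K; lra.
by move=> x; exact: le_g.
Qed.

Let below_envelope z x : E z ->
  f z + ip (G z) (x - z) - M * psi `|x - z| <= envelope psi K g x.
Proof.
move=> Ez; pose h x := f z + ip (G z) (x - z) - M * psi `|x - z|.
rewrite -/(h x); apply: le_envelope; last by move=> y; exact: le_g.
move=> l u v l0 l1.
have := cone_paraconcave (- f z) (- G z) z psiP hip M0 u v l0 l1.
rewrite !linearNl/= /h /K; lra.
Qed.

(** At a point [y] of [E] the envelope is squeezed between two cones with vertex
    [y], which have the value [f y] and the slope [G y] there. *)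
Lemma extension : exists F : X -> R,
  [/\ forall x, differentiable F x,
      forall y, E y -> F y = f y /\ grad ip F y = G y,
      forall x v, `|F (x + v) - F x - ip (grad ip F x) v| <= 24 * M * W `|v|,
      forall x y, `|grad ip F x - grad ip F y| <= 6 * (24 * M) * w `|x - y| &
      forall x y, F x - F y <= (B + M * w 1) * `|x - y|].
Proof.
have K0 : 0 <= K by rewrite mulr_ge0.
pose F := envelope psi K g; have FL := envelope_lipschitz minorant g_lipschitz.
have [T FT] := paraconvex_gradient psiP hip K0 (envelope_paraconvex minorant)
  (envelope_paraconcave minorant g_paraconcave) FL.
rewrite -/F in FL FT.
have dT x := expansion_diff psiP hip K0 (FT x).
have gradE x : grad ip F x = T x by exact/(grad_eq hip)/(dT x).2.
have psiW v : psi `|v : X| <= W `|v| by exact: (truncW_le wW).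
exists F; split => //.
- by move=> x; have [] := dT x.
- move=> y Ey; have Fy : F y = f y.
    apply/eqP; rewrite eq_le; apply/andP; split.
      apply: le_trans (envelope_le minorant y) _; apply: le_trans (g_le y Ey) _.
      by rewrite /cone subrr linear0r normr0 (mp0 psiP) mulr0 !addr0.
    have := below_envelope y Ey.
    by rewrite subrr linear0r normr0 (mp0 psiP) mulr0 addr0 subr0.
  split=> //; apply: (grad_eq hip).
  apply: (expansion_diff psiP hip M0 _).2 => v; rewrite Fy.
  have := below_envelope (y + v) Ey.
  have := le_trans (envelope_le minorant (y + v)) (g_le (y + v) Ey).
  rewrite /cone [y + v - y]addrAC subrr add0r -/F ler_norml => h1 h2.
  apply/andP; split; lra.
- move=> x v; rewrite gradE; apply: le_trans (FT x v) _.
  by rewrite -/K ler_wpM2l.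
- move=> x y; rewrite !gradE; apply: le_trans (expansion_modulus psiP hip K0 FT x y) _.
  by rewrite -/K ler_wpM2l ?mulr_ge0// (truncw_le wW).
Qed.

End Extension.

Theorem theorem5p1 (R : realType) (omega : R -> R)
    (homega : modulus_of_continuity omega) :
  exists C : R, 0 < C /\
    forall (X : completeNormedModType R) (ip : {dot X for idfun}),
      induces_norm ip ->
    forall (E : set X) (f : X -> R) (G : X -> X), E !=set0 ->
      ((exists F : X -> R,
          [/\ C1omega ip omega F, lipschitz F &
              forall y : X, E y -> F y = f y /\ grad ip F y = G y])
       <->
       [/\ [lipschitz f x | x in E], [bounded G x | x in E] &
           (jetA ip omega E f G < +oo)%E])
      /\
      ([/\ [lipschitz f x | x in E], [bounded G x | x in E] &
           (jetA ip omega E f G < +oo)%E] ->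
       exists F : X -> R,
         [/\ C1omega ip omega F, lipschitz F,
             forall y : X, E y -> F y = f y /\ grad ip F y = G y &
             (jetA ip omega setT F (grad ip F) + Lip setT F
              <= C%:E * (jetA ip omega E f G + Lip E f + supnorm E G))%E]).
Proof.
have wW := moc_primitive homega.
have w1 := modulus_ge0 wW ler01; have W1 := phi_gt0 homega ltr01.
(* With [M <= c (A + L + B)], the seminorms of the extension add up to at most
   [24 M + B + M omega 1]. *)
pose c := 1 + 2 / phi omega 1.
have c1 : 1 <= c by rewrite lerDl divr_ge0// ltW.
exists ((24 + omega 1) * c + 1); split.
  rewrite ltr_wpDl// mulr_ge0//; [exact: addr_ge0|exact: le_trans ler01 c1].
move=> X ip hip E f G E0.
pose jet_ok := [/\ [lipschitz f x | x in E], [bounded G x | x in E] &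
  (jetA ip omega E f G < +oo)%E].
have ext : jet_ok -> exists F : X -> R,
   [/\ C1omega ip omega F, lipschitz F,
       forall y : X, E y -> F y = f y /\ grad ip F y = G y &
       (jetA ip omega setT F (grad ip F) + Lip setT F
        <= ((24 + omega 1) * c + 1)%:E *
           (jetA ip omega E f G + Lip E f + supnorm E G))%E].
  move=> [/(Lip_fin E0)[L [L0 LE fL]] /(supnorm_fin E0)[B [B0 BE GB]]].
  move=> /(jetA_fin homega)[A [A0 AE fGA]].
  pose M := A + 2 / phi omega 1 * (L + B).
  have d0 : 0 <= 2 / phi omega 1 by rewrite divr_ge0// ltW.
  have M0 : 0 <= M by rewrite addr_ge0// mulr_ge0// addr_ge0.
  have K0 : 0 <= 24 * M by rewrite mulr_ge0.
  have [F [dF FE Fexp gradF FL]] := extension wW W1 hip E0 A0 L0 B0 fL GB fGA.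
  rewrite -/M in Fexp gradF FL.
  have N0 : 0 <= B + M * omega 1 by rewrite addr_ge0// mulr_ge0.
  exists F; split => //.
  - split=> //; exists (6 * (24 * M) + 1); split.
      by rewrite ltr_wpDl// mulr_ge0.
    move=> x y; apply: le_trans (gradF x y) _.
    by rewrite ler_wpM2r ?(modulus_ge0 wW)// lerDl.
  - apply: (@klipschitzW _ _ _ (B + M * omega 1)).
      exact: (@globally_properfilter _ _ (0, 0)).
    by apply: lipschitz_le => x y _ _; exact: FL.
  - have jF : (jetA ip omega setT F (grad ip F) <= (24 * M)%:E)%E.
      by apply: (jetA_le (primitive_ge0 wW) K0) => y v _; exact: Fexp.
    have lF : (Lip setT F <= (B + M * omega 1)%:E)%E.
      by apply: Lip_le => // x y _ _; exact: FL.
    apply: le_trans (leeD jF lF) _; rewrite AE LE BE -!EFinD -EFinM lee_fin.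
    have cw : 0 <= 24 + omega 1 by rewrite addr_ge0.
    have Mc : M <= c * (A + L + B).
      by rewrite /M /c; have := mulr_ge0 d0 A0; lra.
    by have := ler_wpM2l cw Mc; lra.
split; last exact: ext.
split; last by move=> /ext[F [F1 FL FE _]]; exists F.
move=> [F [[dF [K [K0 gradF]]] FL FE]].
have Fexp x v : `|F (x + v) - F x - ip (grad ip F x) v| <= 4 * K * phi omega `|v|.
  apply: le_trans (grad_modulus_expansion hip (ltW K0) (mp_homo wW) dF gradF x v) _.
  by rewrite [4 * K]mulrC -mulrA ler_pM2l// (mul_le_primitive wW).
have K4 : 0 <= 4 * K by rewrite mulr_ge0// ltW.
split.
- move: FL; rewrite /lipschitz_on; apply: filterS => M FM [x y] [/= Ex Ey].
  by rewrite -(FE _ Ex).1 -(FE _ Ey).1; exact: (FM (x, y)).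
- have : \forall M \near +oo, 0 <= M /\ M.-lipschitz F.
    by apply: filterI; [apply: nbhs_pinfty_ge; exact: num_real|exact: FL].
  apply: filterS => M [M0 FM] y Ey /=; rewrite -(FE _ Ey).2.
  apply: (grad_le_lipschitz wW hip K4 M0 _ (Fexp y)) => u v.
  exact: le_trans (ler_norm _) (FM (u, v) (conj I I)).
- apply: (@le_lt_trans _ _ (4 * K)%:E); last exact: ltry.
  apply: (@jetA_le _ _ _ _ _ _ F) => //; first exact: primitive_ge0 wW.
  by move=> y v Ey; have [<- <-] := FE _ Ey; exact: Fexp.
Qed.
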